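(* Let $k,m>0$ and let $q_0$ satisfy $1+4k<4q_0$; put $\mu=\frac12\sqrt{4(q_0-k)-1}$. Consider the Sturm-Liouville problem in Liouville normal form $$\text{(N)}\qquad -\frac{d^2v}{dt^2}+\frac{k}{(t+m)^2}v=\lambda v,\quad 0<t<\pi,\qquad v(0)=0=v(\pi),$$ with constant potential function $q=q_0$, density function $r=\tau^2$, where $\tau=t+m$, and $\overline\omega=\overline\omega_1(\tau)=\sqrt\tau\,\cos(\mu\ln\tau)$. Assume $\mu\ln m\neq\pi\left(n-\frac12\right)$ and $\mu\ln(\pi+m)\neq\pi\left(n-\frac12\right)$ for all $n\in\mathbb Z$. Then for every $x_0\in\mathbb R$, (N) has, asymptotically (to leading order about $\tau=1$), the canonical form $$-\frac{d}{dx}\left\{\cos^4\big[\mu\ln(1+x+x_0)\big]\frac{du}{dx}\right\}+q_0\,u=\lambda\,(1+x+x_0)^2\,u,\qquad a<x<b,$$ with Dirichlet boundary conditions $u(a)=0=u(b)$, where $$a=-x_0+m-1,\qquad b=-x_0+\pi+m-1,$$ $$\delta_0=m\cos^2(\mu\ln m),\qquad \gamma_0=(\pi+m)\cos^2[\mu\ln(\pi+m)].$$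
   Context: A canonical form is a problem $-(p\,u')'+q\,u=\lambda r\,u$ on $a<x<b$ with boundary conditions $\delta_0u(a)=0=\gamma_0u(b)$. It is produced from (N) by Liouville's transformation as follows: for given $q,r$ (as functions of $\tau=t+m$) take a nonzero real solution $\overline\omega=1/w$ of $$\frac{1}{\overline\omega}\frac{d^2\overline\omega}{d\tau^2}+\frac qr=\frac{k}{\tau^2},$$ put $p=\overline\omega^{\,4}/r$ and $u=wv$, and let $x$ be determined by $\frac{dx}{d\tau}=\sqrt{p/r}=\overline\omega^{\,2}/r$, i.e. $x+x_0=F(\tau)$ with $F$ an antiderivative of $\overline\omega^{\,2}/r$. (Relations are understood where $\overline\omega\ne0$.) Boundary coefficients: $\delta_0=\overline\omega^{\,2}$ at $\tau=m$ ($t=0$) and $\gamma_0=\overline\omega^{\,2}$ at $\tau=\pi+m$ ($t=\pi$); the conditions are Dirichlet, $u(a)=0=u(b)$, when $\delta_0,\gamma_0\neq0$. ''Asymptotically, to leading order about $\tau=1$'' means: $F$ is normalized by $F(1)=0$ and the exact relation $x+x_0=F(\tau)$ is replaced by $x+x_0=F_{\mathrm{lead}}(\tau)$, where $F_{\mathrm{lead}}$ is the lowest-order nonvanishing term of the Taylor expansion of $F$ about $\tau=1$. The functions $p,r$ are expressed in $x$, and the endpoints $a,b$ corresponding to $\tau=m,\pi+m$ are computed, by means of this leading-order relation. *)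

(* Defs.v *)
(* Stdlib real numbers, with Coquelicot for derivatives. *)
From Stdlib Require Import Reals Factorial.
From Coquelicot Require Import Coquelicot.
Open Scope R_scope.

(* The Sturm-Liouville problem
     - (p y')' + q y = lambda r y   on a < x < b,
     delta0 * y a = 0 = gamma0 * y b. *)
Record sl_problem := SLProblem {
  sl_p : R -> R;
  sl_q : R -> R;
  sl_r : R -> R;
  sl_a : R;
  sl_b : R;
  sl_delta0 : R;
  sl_gamma0 : R
}.

(* [Derive] is total, so the derivatives used are required to exist. *)
Definition sl_equation_at (P : sl_problem) (lam : R) (y : R -> R) (x : R) : Prop :=
  locally x (fun s => ex_derive y s) /\
  ex_derive (fun s => sl_p P s * Derive y s) x /\
  - Derive (fun s => sl_p P s * Derive y s) x + sl_q P x * y x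
    = lam * sl_r P x * y x.

Definition sl_boundary (P : sl_problem) (y : R -> R) : Prop :=
  sl_delta0 P * y (sl_a P) = 0 /\ sl_gamma0 P * y (sl_b P) = 0.

(* Problem (N): - v'' + k / (t + m)^2 v = lambda v on 0 < t < PI, v 0 = 0 = v PI. *)
Definition normal_form (k m : R) : sl_problem :=
  SLProblem (fun _ => 1) (fun t => k / (t + m) ^ 2) (fun _ => 1) 0 PI 1 1.

(* Everything in tau lives on the half-line tau > 0, which contains both
   [m, PI + m] and the expansion point tau = 1, whether or not the latter lies
   in [m, PI + m]. The equation is only required away from the zeros of om. *)
Definition liouville_solution (k : R) (q r om : R -> R) : Prop :=
  (exists tau, 0 < tau /\ om tau <> 0) /\
  (forall tau, 0 < tau ->
     0 < r tau /\ ex_derive om tau /\ ex_derive (Derive om) tau) /\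
  (forall tau, 0 < tau -> om tau <> 0 ->
     1 / om tau * Derive_n om 2 tau + q tau / r tau = k / tau ^ 2).

(* x + x0 = F tau, with dx/dtau = om^2 / r = sqrt (p / r), and F tau0 = 0. *)
Definition normalized_antiderivative (tau0 : R) (r om F : R -> R) : Prop :=
  F tau0 = 0 /\ (forall tau, 0 < tau -> is_derive F tau (om tau ^ 2 / r tau)).

(* The data of P are obtained from q, r and om by expressing them in x through
   the relation x + x0 = G tau, which matches m < tau < PI + m with a < x < b. *)
Definition coefficients_via
    (m : R) (q r om G : R -> R) (x0 : R) (P : sl_problem) : Prop :=
  sl_a P + x0 = G m /\
  sl_b P + x0 = G (PI + m) /\
  sl_delta0 P = om m ^ 2 /\
  sl_gamma0 P = om (PI + m) ^ 2 /\
  (forall x, sl_a P < x < sl_b P ->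
     exists tau, m < tau < PI + m /\ x + x0 = G tau) /\
  (forall tau x, m < tau < PI + m -> x + x0 = G tau ->
     sl_a P < x < sl_b P /\
     sl_p P x = om tau ^ 4 / r tau /\
     sl_q P x = q tau /\
     sl_r P x = r tau).

(* Under u = w v, w = 1 / om, x + x0 = F tau, tau = t + m, the equation of (N)
   becomes that of P wherever om <> 0, and so do the boundary conditions if
   om is nonzero at both endpoints. *)
Definition normal_form_transforms_to
    (k m : R) (om F : R -> R) (x0 : R) (P : sl_problem) : Prop :=
  forall (lam : R) (v u : R -> R),
    (forall t, 0 <= t <= PI -> om (t + m) <> 0 ->
       u (F (t + m) - x0) = / om (t + m) * v t) ->
    (forall t, 0 < t < PI -> om (t + m) <> 0 ->
       (sl_equation_at (normal_form k m) lam v t <->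
        sl_equation_at P lam u (F (t + m) - x0))) /\
    (om m <> 0 -> om (PI + m) <> 0 ->
       (sl_boundary (normal_form k m) v <-> sl_boundary P u)).

Definition taylor_leading_term (F : R -> R) (tau0 : R) (G : R -> R) : Prop :=
  exists n : nat,
    locally tau0 (fun s => forall j : nat, (j <= n)%nat -> ex_derive_n F j s) /\
    (forall j : nat, (j < n)%nat -> Derive_n F j tau0 = 0) /\
    Derive_n F n tau0 <> 0 /\
    (forall tau, G tau = Derive_n F n tau0 / INR (fact n) * (tau - tau0) ^ n).

(* Pex is the exact canonical form produced from (N) by Liouville's
   transformation; P arises from it by replacing x + x0 = F tau with its
   leading-order version x + x0 = Flead tau about tau = tau0. *)
Definition asymptotic_canonical_form
    (tau0 k m : R) (q r om : R -> R) (x0 : R) (P : sl_problem) : Prop :=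
  liouville_solution k q r om /\
  exists (F Flead : R -> R) (Pex : sl_problem),
    normalized_antiderivative tau0 r om F /\
    coefficients_via m q r om F x0 Pex /\
    normal_form_transforms_to k m om F x0 Pex /\
    taylor_leading_term F tau0 Flead /\
    coefficients_via m q r om Flead x0 P.

(* Main.v *)
(* In the variable [s = ln tau] one has [om^2 / r dtau = cos (mu s)^2 ds], so
   [F tau = phase mu (ln tau)] with [phase mu s = s/2 + sin (2 mu s) / (4 mu)], an
   increasing bijection of the line; its inverse expresses the exact canonical form
   in [x]. Since [F 1 = 0] and [F' 1 = 1], the leading term about [1] is [tau - 1].
   For the equivalence of the equations, [p u'] in the variable [x] equals the
   Wronskian [om v' - om' v] in the variable [t], whose derivative is
   [om v'' - om'' v]; the two equations then differ by the factor [r / om]. *)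
Require Import Defs.
From Stdlib Require Import Reals Ranalysis5 Lra Lia.
From Coquelicot Require Import Coquelicot.
Open Scope R_scope.

(** * Inverse functions and the phase function *)

(** Strict monotonicity turns the right inverse [g] into a two-sided, continuous inverse, and the
    reciprocal rule then applies at [y]. Monotonicity is assumed as such, and [f'] is nonzero only
    at [g y], because the derivative of [phase] vanishes at isolated points. *)
Lemma is_derive_inverse (f g f' : R -> R) (y : R) :
  (forall a b, a < b -> f a < f b) ->
  (forall z, f (g z) = z) ->
  (forall s, is_derive f s (f' s)) ->
  f' (g y) <> 0 ->
  is_derive g y (/ f' (g y)).
Proof.
  intros Hinc Hfg Hf Hnz.
  assert (Hgf : forall s, g (f s) = s).
  { intros s. destruct (Rtotal_order (g (f s)) s) as [H|[H|H]]; auto;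
      apply Hinc in H; rewrite Hfg in H; lra. }
  assert (Hginc : forall a b, a <= b -> g a <= g b).
  { intros a b Hab. destruct (Rle_or_lt (g a) (g b)) as [H|H]; auto.
    apply Hinc in H. rewrite !Hfg in H. lra. }
  assert (Hcont : continuity_pt g y).
  { apply (continuity_pt_recip_prelim f g (g y - 1) (g y + 1)).
    - lra.
    - auto.
    - intros; apply Hgf.
    - intros a _. apply derivable_continuous_pt. exists (f' a).
      now apply is_derive_Reals.
    - rewrite <- (Hfg y) at 2 3. split; apply Hinc; lra. }
  assert (Prf : forall a, g (y - 1) <= a <= g (y + 1) -> derivable_pt f a).
  { intros a _. exists (f' a). now apply is_derive_Reals. }
  assert (Hy : g (y - 1) <= g y <= g (y + 1)) by (split; apply Hginc; lra).
  assert (Hd : derive_pt f (g y) (Prf (g y) Hy) = f' (g y)).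
  { apply derive_pt_eq_0. now apply is_derive_Reals. }
  apply is_derive_Reals.
  replace (/ f' (g y)) with (1 / derive_pt f (g y) (Prf (g y) Hy))
    by (rewrite Hd; field; auto).
  apply (derivable_pt_lim_recip_interv f g (y - 1) (y + 1)); try lra; auto.
  - intros; apply Hfg.
Qed.

(** On (0, PI) the sine is positive; from PI on, the bound sin d >= -1 is enough. *)
Lemma sin_gt_neg_id (d : R) : 0 < d -> - d < sin d.
Proof.
  intros Hd. destruct (Rlt_or_le d PI) as [H|H].
  - pose proof (sin_gt_0 d Hd H). lra.
  - pose proof (SIN_bound d). pose proof PI2_1. lra.
Qed.

Definition phase (mu s : R) : R := s / 2 + sin (2 * mu * s) / (4 * mu).

Lemma phase_derive (mu s : R) :
  0 < mu -> is_derive (phase mu) s (cos (mu * s) ^ 2).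
Proof.
  intros Hmu. unfold phase. auto_derive; [lra|].
  replace (2 * mu * s) with (2 * (mu * s)) by ring.
  rewrite cos_2a_cos. field. lra.
Qed.

(* The derivative of [phase] has zeros; strictness comes from
   [|sin x| < |x|] applied to [sin A - sin B = 2 cos ((A+B)/2) sin ((A-B)/2)]. *)
Lemma phase_increasing (mu a b : R) : 0 < mu -> a < b -> phase mu a < phase mu b.
Proof.
  intros Hmu Hab.
  assert (H : 2 * mu * a - 2 * mu * b < sin (2 * mu * b) - sin (2 * mu * a)).
  { rewrite form4.
    replace ((2 * mu * b - 2 * mu * a) / 2) with (mu * (b - a)) by field.
    set (c := cos _). assert (Hd : 0 < mu * (b - a)) by nra.
    pose proof (sin_lt_x _ Hd). pose proof (sin_gt_neg_id _ Hd).
    pose proof (COS_bound ((2 * mu * b + 2 * mu * a) / 2)) as Hc. fold c in Hc.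
    set (d := mu * (b - a)) in *.
    replace (2 * mu * a - 2 * mu * b) with (- (2 * d)) by (unfold d; ring).
    (* The two products below add up to 2 d + 2 c sin d, the quantity to be shown positive. Since
       |c| <= 1 both are nonnegative, and the sign of [c] tells which one is strictly positive. *)
    destruct (Rle_or_lt 0 c).
    - assert (0 < (1 + c) * (d + sin d)) by (apply Rmult_lt_0_compat; lra).
      assert (0 <= (1 - c) * (d - sin d)) by (apply Rmult_le_pos; lra).
      lra.
    - assert (0 <= (1 + c) * (d + sin d)) by (apply Rmult_le_pos; lra).
      assert (0 < (1 - c) * (d - sin d)) by (apply Rmult_lt_0_compat; lra).
      lra. }
  unfold phase.
  assert (E : b / 2 + sin (2 * mu * b) / (4 * mu) - (a / 2 + sin (2 * mu * a) / (4 * mu))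
    = (2 * mu * b - 2 * mu * a + (sin (2 * mu * b) - sin (2 * mu * a))) / (4 * mu))
    by (field; lra).
  assert (0 < (2 * mu * b - 2 * mu * a + (sin (2 * mu * b) - sin (2 * mu * a))) / (4 * mu))
    by (apply Rdiv_lt_0_compat; lra).
  lra.
Qed.

(** [phase mu s] differs from s/2 by at most 1 / (4 mu), so it takes values on both sides of any
    [y], and the intermediate value theorem applies. *)
Lemma phase_surjective (mu : R) :
  0 < mu -> exists h : R -> R, forall y, phase mu (h y) = y.
Proof.
  intros Hmu.
  (* The sigma type lets the inverse be defined by projection. *)
  assert (Hsol : forall y, {s : R | phase mu s = y}).
  { intros y.
    (* Half of [B] is |y| plus the amplitude of the oscillating term, so [y] lies between the values
       at -B and B. *)
    set (B := 2 * (Rabs y + / (4 * mu))).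
    assert (Hi : 0 < / (4 * mu)) by (apply Rinv_0_lt_compat; lra).
    assert (Hsin : forall x, - / (4 * mu) <= sin x / (4 * mu) <= / (4 * mu)).
    { intros x. unfold Rdiv. pose proof (SIN_bound x). nra. }
    destruct (IVT_gen (phase mu) (- B) B y) as [s [_ Hs]].
    - intros x. apply continuity_pt_filterlim.
      apply (ex_derive_continuous (phase mu) x). eexists. now apply phase_derive.
    - pose proof (Hsin (2 * mu * B)). pose proof (Hsin (2 * mu * - B)).
      pose proof (Rle_abs y). pose proof (Rle_abs (- y)) as Hn. rewrite Rabs_Ropp in Hn.
      split.
      + eapply Rle_trans; [apply Rmin_l|]. unfold phase, B in *. lra.
      + eapply Rle_trans; [|apply Rmax_r]. unfold phase, B in *. lra.
    - now exists s. }
  exists (fun y => proj1_sig (Hsol y)). intros y. exact (proj2_sig (Hsol y)).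
Qed.


(** * Liouville's transformation in a chart *)

(* [X] is the new variable as a function of [t], [T] its inverse. *)
Record liouville_chart (D : R -> Prop) (om om1 rho X T : R -> R) : Prop := {
  chart_open : open D;
  chart_om : forall t, D t -> om t <> 0;
  chart_rho : forall t, D t -> rho t <> 0;
  chart_om_derive : forall t, D t -> is_derive om t (om1 t);
  chart_X_derive : forall t, D t -> is_derive X t (om t ^ 2 / rho t);
  chart_T_derive : forall t, D t -> is_derive T (X t) (rho t / om t ^ 2);
  chart_TX : forall t, D t -> T (X t) = t;
  chart_XT : forall x, X (T x) = x
}.
Arguments chart_open {D om om1 rho X T}.
Arguments chart_om {D om om1 rho X T}.
Arguments chart_rho {D om om1 rho X T}.
Arguments chart_om_derive {D om om1 rho X T}.
Arguments chart_X_derive {D om om1 rho X T}.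
Arguments chart_T_derive {D om om1 rho X T}.
Arguments chart_TX {D om om1 rho X T}.
Arguments chart_XT {D om om1 rho X T}.

Section Chart.
Context (D : R -> Prop) (om om1 rho X T : R -> R)
  (C : liouville_chart D om om1 rho X T).

(** Continuity of [T] at [X t] carries a neighbourhood of [t] over to one of [X t]; there X (T x) =
    x. *)
Lemma chart_locally (t : R) (Q : R -> Prop) :
  D t -> locally t (fun s => D s -> Q (X s)) -> locally (X t) Q.
Proof.
  intros Ht HQ.
  assert (HT : continuous T (X t)).
  { apply (ex_derive_continuous T). eexists. apply (chart_T_derive C t Ht). }
  assert (HD : locally (T (X t)) (fun s => Q (X s))).
  { rewrite (chart_TX C t Ht).
    generalize (filter_and _ _ HQ (chart_open C t Ht)).
    apply filter_imp. tauto. }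
  generalize (HT _ HD). unfold filtermap. apply filter_imp. intros x.
  now rewrite (chart_XT C x).
Qed.

Lemma chart_pull_locally (t : R) (Q : R -> Prop) :
  D t -> locally (X t) Q -> locally t (fun s => Q (X s)).
Proof.
  intros Ht HQ.
  assert (HX : continuous X t).
  { apply (ex_derive_continuous X). eexists. apply (chart_X_derive C t Ht). }
  exact (HX _ HQ).
Qed.

(** Chain rule through [X]; [chart_push] is its counterpart through [T]. The functions are matched
    only near [t] and on [D], since u = v / om makes sense only off the zeros of [om]. *)
Lemma chart_pull (f g : R -> R) (t l : R) :
  D t -> locally t (fun s => D s -> g (X s) = f s) ->
  is_derive g (X t) l -> is_derive f t (om t ^ 2 / rho t * l).
Proof.
  intros Ht Hfg Hg.
  apply is_derive_ext_loc with (fun s => g (X s)).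
  - generalize (filter_and _ _ Hfg (chart_open C t Ht)).
    apply filter_imp. tauto.
  - apply (is_derive_comp g X); auto. apply (chart_X_derive C t Ht).
Qed.

Lemma chart_push (f g : R -> R) (t l : R) :
  D t -> locally t (fun s => D s -> g (X s) = f s) ->
  is_derive f t l -> is_derive g (X t) (rho t / om t ^ 2 * l).
Proof.
  intros Ht Hfg Hf.
  apply is_derive_ext_loc with (fun x => f (T x)).
  - apply chart_locally; auto. revert Hfg. apply filter_imp. intros s Hs HD.
    rewrite (chart_TX C s HD). symmetry; auto.
  - apply (is_derive_comp f T).
    + now rewrite (chart_TX C t Ht).
    + apply (chart_T_derive C t Ht).
Qed.

Context (P : sl_problem) (v u : R -> R)
  (HP : forall s, D s -> sl_p P (X s) = om s ^ 4 / rho s)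
  (Hu : forall s, D s -> u (X s) = / om s * v s).

(** In the variable [t] the unknowns are related by u = v / om and v = om u, with [om]
    differentiable and nonzero on [D]. *)
Lemma chart_unknown_iff (t : R) : D t -> (ex_derive v t <-> ex_derive u (X t)).
Proof.
  intros Ht.
  pose proof (chart_om_derive C t Ht) as Ho.
  pose proof (chart_om C t Ht) as Hn.
  split; intros [l Hl].
  - exists (rho t / om t ^ 2 * Derive (fun s => / om s * v s) t).
    apply (chart_push (fun s => / om s * v s) u t _ Ht (filter_forall _ Hu)).
    apply (Derive_correct (fun s => / om s * v s)).
    auto_derive. repeat split; auto; eexists; eauto.
  - apply ex_derive_ext_loc with (fun s => om s * (/ om s * v s)).
    + generalize (chart_open C t Ht). apply filter_imp. intros s Hs.
      pose proof (chart_om C s Hs).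
      change (om s * (/ om s * v s) = v s :> R). field; auto.
    + apply (ex_derive_mult om (fun s => / om s * v s)).
      * eexists; eauto.
      * exists (om t ^ 2 / rho t * l). now apply (chart_pull _ u t _ Ht (filter_forall _ Hu)).
Qed.

(** The derivative of v / om is the Wronskian over om^2. The change of variable multiplies it by rho
    / om^2, and p = om^4 / rho cancels both factors. *)
Lemma chart_flux (t : R) :
  D t -> ex_derive v t ->
  sl_p P (X t) * Derive u (X t) = om t * Derive v t - om1 t * v t.
Proof.
  intros Ht Hv.
  pose proof (chart_om_derive C t Ht) as Ho.
  pose proof (chart_om C t Ht) as Hn.
  pose proof (chart_rho C t Ht) as Hr.
  assert (H : is_derive (fun s => / om s * v s) t
    ((om t * Derive v t - om1 t * v t) / om t ^ 2)).
  { auto_derive.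
    - repeat split; auto; eexists; eauto.
    - rewrite (is_derive_unique (fun x : R => om x) t (om1 t)) by auto.
      change (fun x : R => Derive v x) with (Derive v); change (fun x : R => v x) with v.
      field; auto. }
  apply (chart_push _ u t _ Ht (filter_forall _ Hu)) in H.
  rewrite (is_derive_unique _ _ _ H), (HP t Ht). field; auto.
Qed.

(** The clauses of [sl_equation_at] are transferred in order: differentiability of the unknown near
    the point, differentiability of the flux at the point, then the equation. The later ones rely on
    the first, because the flux identity holds where [v] is differentiable. *)
Lemma chart_equation_iff (k m lam t q om2 : R) :
  D t ->
  is_derive om1 t om2 ->
  om2 / om t + q / rho t = k / (t + m) ^ 2 ->
  sl_q P (X t) = q ->
  sl_r P (X t) = rho t ->
  sl_equation_at (normal_form k m) lam v t <-> sl_equation_at P lam u (X t).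
Proof.
  intros Ht Ho2 Hl Hq Hr.
  pose proof (chart_om_derive C t Ht) as Ho.
  pose proof (chart_om C t Ht) as Hn.
  pose proof (chart_rho C t Ht) as Hrn.
  set (W := fun s => om s * Derive v s - om1 s * v s).
  set (U := fun x => sl_p P x * Derive u x).
  assert (Hloc : locally t (fun s => ex_derive v s) <->
                 locally (X t) (fun x => ex_derive u x)).
  { split; intros H.
    - apply chart_locally; auto. revert H. apply filter_imp. intros s Hs HD.
      now apply chart_unknown_iff.
    - generalize (filter_and _ _ (chart_pull_locally _ _ Ht H)
        (chart_open C t Ht)).
      apply filter_imp. intros s [Hs HD]. now apply chart_unknown_iff. }
  assert (HUW : locally t (fun s => ex_derive v s) ->
                locally t (fun s => D s -> U (X s) = W s)).
  { apply filter_imp. intros s Hs HD. now apply chart_flux. }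
  (* The two products om' v' cancel, so no first derivative of [v] remains. *)
  assert (HW : ex_derive v t -> ex_derive (Derive v) t ->
    is_derive W t (om t * Derive (Derive v) t - om2 * v t)).
  { intros Hv Hv2. unfold W. auto_derive.
    - repeat split; auto; eexists; eauto.
    - rewrite (is_derive_unique (fun x : R => om x) t (om1 t)) by auto.
      rewrite (is_derive_unique (fun x : R => om1 x) t om2) by auto.
      change (fun x : R => Derive v x) with (Derive v); change (fun x : R => v x) with v.
      ring. }
  assert (Hex : locally t (fun s => ex_derive v s) ->
    (ex_derive (Derive v) t <-> ex_derive U (X t))).
  { intros Hv. pose proof (locally_singleton _ _ Hv) as Hvt. split.
    - intros Hv2. exists (rho t / om t ^ 2 * (om t * Derive (Derive v) t - om2 * v t)).
      apply (chart_push W U t _ Ht (HUW Hv)), HW; auto.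
    - intros [l H]. apply (chart_pull W U t _ Ht (HUW Hv)) in H.
      (* Solving the definition of [W] for v' shows that v' is differentiable as soon as [W] is. *)
      apply ex_derive_ext_loc with (fun s => / om s * (W s + om1 s * v s)).
      + generalize (chart_open C t Ht). apply filter_imp. intros s Hs.
        pose proof (chart_om C s Hs).
        change (/ om s * (W s + om1 s * v s) = Derive v s :> R). unfold W. field; auto.
      + assert (ex_derive W t) by (eexists; eauto).
        auto_derive. repeat split; auto; eexists; eauto. }
  assert (Hval : locally t (fun s => ex_derive v s) -> ex_derive (Derive v) t ->
    (- Derive (Derive v) t + k / (t + m) ^ 2 * v t = lam * v t <->
     - Derive U (X t) + q * u (X t) = lam * rho t * u (X t))).
  { intros Hv Hv2. pose proof (locally_singleton _ _ Hv) as Hvt.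
    pose proof (chart_push W U t _ Ht (HUW Hv) (HW Hvt Hv2)) as HU.
    rewrite (is_derive_unique _ _ _ HU), (Hu t Ht), <- Hl.
    (* The residuals of the two equations differ by the nonzero factor rho / om, so they vanish
       together. *)
    assert (E : - (rho t / om t ^ 2 * (om t * Derive (Derive v) t - om2 * v t))
        + q * (/ om t * v t) - lam * rho t * (/ om t * v t)
      = rho t / om t * (- Derive (Derive v) t + (om2 / om t + q / rho t) * v t
          - lam * v t)) by (field; auto).
    assert (Hnz : rho t / om t <> 0).
    { unfold Rdiv. apply Rmult_integral_contrapositive.
      split; auto. now apply Rinv_neq_0_compat. }
    split; intros H.
    - apply Rminus_diag_uniq. rewrite E.
      rewrite H. ring.
    - apply Rminus_diag_uniq. apply (Rmult_eq_reg_l (rho t / om t)); auto.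
      rewrite <- E, H. ring. }
  (* The normal form has p = 1, so its flux appears literally as 1 * v'. *)
  assert (E1 : forall s, 1 * Derive v s = Derive v s) by (intros; ring).
  unfold sl_equation_at, normal_form; cbn [sl_p sl_q sl_r].
  fold U. rewrite Hq, Hr, (Derive_ext _ _ t E1), Rmult_1_r.
  split.
  - intros [Hv [Hv2 H]]. apply (ex_derive_ext _ _ t E1) in Hv2.
    split; [|split]; [now apply Hloc|now apply Hex|apply (Hval Hv Hv2), H].
  - intros [Hul [Hu2 H]]. apply Hloc in Hul as Hv. apply (Hex Hv) in Hu2 as Hv2.
    split; [|split]; auto.
    + revert Hv2. apply ex_derive_ext. auto.
    + now apply (Hval Hv Hv2).
Qed.
End Chart.

(** * The solution [omega] of an Euler equation *)

Lemma is_derive_shift (f : R -> R) (m t l : R) :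
  is_derive f (t + m) l -> is_derive (fun s => f (s + m)) t l.
Proof.
  intros Hf. rewrite <- (Rmult_1_l l).
  apply (is_derive_comp f (fun s => s + m)); auto. auto_derive; auto.
Qed.
Definition omega (mu tau : R) : R := sqrt tau * cos (mu * ln tau).
Definition omega1 (mu tau : R) : R :=
  (cos (mu * ln tau) / 2 - mu * sin (mu * ln tau)) / sqrt tau.

Lemma omega_derive (mu tau : R) :
  0 < tau -> is_derive (omega mu) tau (omega1 mu tau).
Proof.
  intros Ht. pose proof (sqrt_lt_R0 tau Ht) as Hs.
  unfold omega, omega1. auto_derive; [auto|].
  rewrite <- (sqrt_sqrt tau) at 4 by lra. field. lra.
Qed.

(** [omega mu] is the real part of tau^s with s = 1/2 + i mu, and s (s - 1) = -(1/4 + mu^2); hence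
    the Euler equation. *)
Lemma omega1_derive (mu tau : R) :
  0 < tau ->
  is_derive (omega1 mu) tau (- (1 / 4 + mu ^ 2) / tau ^ 2 * omega mu tau).
Proof.
  intros Ht. pose proof (sqrt_lt_R0 tau Ht) as Hs.
  unfold omega, omega1. auto_derive; [repeat split; auto; lra|].
  set (S := sqrt tau) in *.
  (* With tau = S * S and the trigonometric values named, the identity is rational in [S]. *)
  replace tau with (S * S) by (apply sqrt_sqrt; lra).
  set (c := cos _). set (s := sin _). field. lra.
Qed.

Lemma omega_sq (mu tau : R) :
  0 < tau -> omega mu tau ^ 2 = tau * cos (mu * ln tau) ^ 2.
Proof.
  intros Ht. unfold omega. rewrite Rpow_mult_distr, pow2_sqrt; lra.
Qed.

Lemma omega_neq0 (mu tau : R) :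
  0 < tau -> cos (mu * ln tau) <> 0 <-> omega mu tau <> 0.
Proof.
  intros Ht. pose proof (sqrt_lt_R0 tau Ht). unfold omega. split; intros H1 H2; apply H1.
  - apply Rmult_integral in H2. lra.
  - rewrite H2. ring.
Qed.

(** Since q / r = q0 / tau^2, the Euler equation makes the left side (q0 - 1/4 - mu^2) / tau^2,
    which is k / tau^2 by the choice of [mu]. *)
Lemma omega_liouville_solution (k q0 mu : R) :
  mu ^ 2 = q0 - k - 1 / 4 ->
  liouville_solution k (fun _ => q0) (fun tau => tau ^ 2) (omega mu).
Proof.
  intros Hmu. split; [|split].
  - exists 1. split; [lra|]. apply omega_neq0; [lra|].
    rewrite ln_1, Rmult_0_r, cos_0. lra.
  - intros tau Ht. split; [|split].
    + now apply pow_lt.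
    + eexists. now apply omega_derive.
    + apply ex_derive_ext_loc with (omega1 mu).
      * apply (locally_open (fun x => 0 < x)); auto using open_gt.
        intros x Hx. symmetry. apply is_derive_unique. now apply omega_derive.
      * eexists. now apply omega1_derive.
  - intros tau Ht Hn.
    replace (Derive_n (omega mu) 2 tau) with (- (1 / 4 + mu ^ 2) / tau ^ 2 * omega mu tau).
    + rewrite Hmu. field. lra.
    + symmetry. change (Derive (Derive (omega mu)) tau
        = - (1 / 4 + mu ^ 2) / tau ^ 2 * omega mu tau).
      rewrite (Derive_ext_loc _ (omega1 mu)).
      * apply is_derive_unique. now apply omega1_derive.
      * apply (locally_open (fun x => 0 < x)); auto using open_gt.
        intros x Hx. apply is_derive_unique. now apply omega_derive.
Qed.

(** * The normalized antiderivative and its leading term *)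

Lemma phase_ln_derive (mu tau : R) :
  0 < mu -> 0 < tau ->
  is_derive (fun s => phase mu (ln s)) tau (omega mu tau ^ 2 / tau ^ 2).
Proof.
  intros Hmu Ht.
  replace (omega mu tau ^ 2 / tau ^ 2) with (scal (/ tau) (cos (mu * ln tau) ^ 2)).
  - apply (is_derive_comp (phase mu) ln).
    + now apply phase_derive.
    + now apply is_derive_Reals, derivable_pt_lim_ln.
  - rewrite omega_sq by auto.
    change (/ tau * cos (mu * ln tau) ^ 2 = tau * cos (mu * ln tau) ^ 2 / tau ^ 2 :> R).
    field. lra.
Qed.

Lemma phase_ln_normalized (mu : R) :
  0 < mu ->
  normalized_antiderivative 1 (fun tau => tau ^ 2) (omega mu) (fun tau => phase mu (ln tau)).
Proof.
  intros Hmu. split.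
  - unfold phase. rewrite ln_1, Rmult_0_r, sin_0. field. lra.
  - intros tau Ht. now apply phase_ln_derive.
Qed.

Lemma phase_ln_leading_term (mu : R) :
  0 < mu -> taylor_leading_term (fun tau => phase mu (ln tau)) 1 (fun tau => tau - 1).
Proof.
  intros Hmu. pose proof (phase_ln_normalized mu Hmu) as [H0 Hd].
  assert (H1 : Derive_n (fun tau => phase mu (ln tau)) 1 1 = 1).
  { change (Derive (fun tau => phase mu (ln tau)) 1 = 1).
    rewrite (is_derive_unique _ _ _ (Hd 1 Rlt_0_1)), omega_sq by lra.
    rewrite ln_1, Rmult_0_r, cos_0. field. }
  exists 1%nat. split; [|split; [|split]].
  - apply (locally_open (fun x => 0 < x)); auto using open_gt, Rlt_0_1.
    intros x Hx j Hj. destruct j as [|[|j]]; [exact I| |lia].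
    eexists. now apply Hd.
  - intros j Hj. replace j with 0%nat by lia. exact H0.
  - rewrite H1. lra.
  - intros tau. rewrite H1. simpl. field.
Qed.

Lemma phase_ln_increasing (mu a b : R) :
  0 < mu -> 0 < a -> 0 < b -> (phase mu (ln a) < phase mu (ln b) <-> a < b).
Proof.
  intros Hmu Ha Hb. split; intros H.
  - destruct (Rtotal_order a b) as [Hab|[->|Hab]]; auto; [lra|].
    pose proof (phase_increasing mu _ _ Hmu (ln_increasing _ _ Hb Hab)). lra.
  - apply phase_increasing; auto. now apply ln_increasing.
Qed.

(** * The exact canonical form *)

Section Exact.
Context (k m q0 mu x0 : R) (h : R -> R)
  (Hm : 0 < m) (Hmu : 0 < mu) (Hmu2 : mu ^ 2 = q0 - k - 1 / 4)
  (Hh : forall y, phase mu (h y) = y).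

(** As [h] inverts the phase, [h (x + x0)] stands for ln tau and its exponential for tau; p = om^4 /
    r becomes cos^4 (mu ln tau). *)
Definition exact_form : sl_problem :=
  {| sl_p := fun x => cos (mu * h (x + x0)) ^ 4;
     sl_q := fun _ => q0;
     sl_r := fun x => exp (h (x + x0)) ^ 2;
     sl_a := phase mu (ln m) - x0;
     sl_b := phase mu (ln (PI + m)) - x0;
     sl_delta0 := omega mu m ^ 2;
     sl_gamma0 := omega mu (PI + m) ^ 2 |}.

Lemma phase_inverse (s : R) : h (phase mu s) = s.
Proof.
  destruct (Rtotal_order (h (phase mu s)) s) as [H|[H|H]]; auto;
    apply (phase_increasing mu) in H; auto; rewrite Hh in H; lra.
Qed.

Lemma omega_pow4 (tau : R) :
  0 < tau -> omega mu tau ^ 4 / tau ^ 2 = cos (mu * ln tau) ^ 4.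
Proof.
  intros Ht. replace (omega mu tau ^ 4) with ((omega mu tau ^ 2) ^ 2) by ring.
  rewrite omega_sq by auto. field. lra.
Qed.

Lemma exact_form_coefficients :
  coefficients_via m (fun _ => q0) (fun tau => tau ^ 2) (omega mu)
    (fun tau => phase mu (ln tau)) x0 exact_form.
Proof.
  pose proof PI_RGT_0 as Hpi.
  unfold coefficients_via, exact_form; cbn [sl_p sl_q sl_r sl_a sl_b sl_delta0 sl_gamma0].
  split; [ring|]. split; [ring|]. split; [auto|]. split; [auto|]. split.
  - intros x Hx. exists (exp (h (x + x0))).
    assert (E : phase mu (ln (exp (h (x + x0)))) = x + x0) by now rewrite ln_exp.
    pose proof (exp_pos (h (x + x0))).
    split; [|auto].
    split; apply (phase_ln_increasing mu); auto; lra.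
  - intros tau x Ht Hx.
    assert (E : h (x + x0) = ln tau) by (rewrite Hx; apply phase_inverse).
    assert (H1 : phase mu (ln m) < phase mu (ln tau)) by (apply phase_ln_increasing; lra).
    assert (H2 : phase mu (ln tau) < phase mu (ln (PI + m)))
      by (apply phase_ln_increasing; lra).
    rewrite E, exp_ln, omega_pow4 by lra. repeat split; lra.
Qed.

(** The open set on which u = v / om is defined and the inverse change of variable is
    differentiable. *)
Definition regular_set (t : R) : Prop :=
  (0 < t /\ t < PI) /\ omega mu (t + m) <> 0.

Lemma exact_form_chart :
  liouville_chart regular_set
    (fun t => omega mu (t + m)) (fun t => omega1 mu (t + m)) (fun t => (t + m) ^ 2)
    (fun t => phase mu (ln (t + m)) - x0) (fun x => exp (h (x + x0)) - m).
Proof.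
  assert (Hom : forall t, 0 < t -> is_derive (fun t => omega mu (t + m)) t (omega1 mu (t + m))).
  { intros t Ht. apply is_derive_shift, omega_derive. lra. }
  split.
  - intros t [[H1 H2] H3]. unfold regular_set. apply filter_and; [apply filter_and|].
    + now apply open_gt.
    + now apply open_lt.
    + assert (Hc : continuous (fun t => omega mu (t + m)) t).
      { apply (ex_derive_continuous (fun t => omega mu (t + m))). eexists. now apply Hom. }
      apply (Hc (fun y => y <> 0)). now apply open_neq.
  - intros t [_ H]. exact H.
  - intros t [H _]. apply pow_nonzero. lra.
  - intros t [H _]. now apply Hom.
  - intros t [H _].
    replace (omega mu (t + m) ^ 2 / (t + m) ^ 2)
      with (omega mu (t + m) ^ 2 / (t + m) ^ 2 - 0) by ring.
    apply (is_derive_minus (fun t => phase mu (ln (t + m))) (fun _ => x0)).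
    + apply (is_derive_shift (fun s => phase mu (ln s))), phase_ln_derive; lra.
    + apply (is_derive_const x0).
  - intros t [Ht Hn].
    assert (Hpos : 0 < t + m) by lra. apply omega_neq0 in Hn; auto.
    set (x := phase mu (ln (t + m)) - x0).
    assert (Hx : h (x + x0) = ln (t + m)).
    { replace (x + x0) with (phase mu (ln (t + m))) by (unfold x; ring).
      apply phase_inverse. }
    (* The phase has a nonzero derivative at ln (t + m) precisely because [omega] does not vanish at
       t + m. *)
    assert (Hdh : is_derive h (x + x0) (/ cos (mu * ln (t + m)) ^ 2)).
    { rewrite <- Hx.
      apply (is_derive_inverse (phase mu) h (fun s => cos (mu * s) ^ 2)); auto.
      - intros a b. now apply phase_increasing.
      - intros s. now apply phase_derive.
      - rewrite Hx. now apply pow_nonzero. }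
    auto_derive.
    + repeat split; auto. eexists; eauto.
    + rewrite (is_derive_unique (fun y : R => h y) _ _ Hdh), Hx, exp_ln, omega_sq by auto.
      field. lra.
  - intros t [Ht _].
    replace (phase mu (ln (t + m)) - x0 + x0) with (phase mu (ln (t + m))) by ring.
    rewrite phase_inverse, exp_ln by lra. ring.
  - intros x. replace (exp (h (x + x0)) - m + m) with (exp (h (x + x0))) by ring.
    rewrite ln_exp, Hh. ring.
Qed.

Lemma exact_form_transforms :
  normal_form_transforms_to k m (omega mu) (fun tau => phase mu (ln tau)) x0 exact_form.
Proof.
  pose proof PI_RGT_0 as Hpi.
  intros lam v u Huv. split.
  - intros t Ht Hn.
    assert (Hxt : forall s, h (phase mu (ln (s + m)) - x0 + x0) = ln (s + m)).
    { intros s. replace (phase mu (ln (s + m)) - x0 + x0) with (phase mu (ln (s + m))) by ring.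
      apply phase_inverse. }
    refine (chart_equation_iff _ _ _ _ _ _ exact_form_chart exact_form v u _ _
      k m lam t q0 (- (1 / 4 + mu ^ 2) / (t + m) ^ 2 * omega mu (t + m)) _ _ _ _ _).
    + intros s [Hs _]. unfold exact_form; cbn [sl_p].
      rewrite Hxt, omega_pow4; lra.
    + intros s [Hs Hns]. apply Huv; auto. lra.
    + now split.
    + apply is_derive_shift, omega1_derive. lra.
    + rewrite Hmu2. field. lra.
    + reflexivity.
    + unfold exact_form; cbn [sl_r]. rewrite Hxt, exp_ln; lra.
  - intros Hn1 Hn2. unfold sl_boundary, exact_form, normal_form.
    cbn [sl_a sl_b sl_delta0 sl_gamma0].
    pose proof (Huv 0) as H0. pose proof (Huv PI) as H1. cbv beta in H0, H1.
    rewrite Rplus_0_l in H0. rewrite H0, H1 by (auto; lra).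
    (* At an endpoint the condition om^2 u = 0 reads om v = 0, equivalent to v = 0 as [omega] is
       nonzero there. *)
    assert (E1 : omega mu m ^ 2 * (/ omega mu m * v 0) = omega mu m * v 0) by (field; auto).
    assert (E2 : omega mu (PI + m) ^ 2 * (/ omega mu (PI + m) * v PI)
      = omega mu (PI + m) * v PI) by (field; auto).
    rewrite E1, E2. split; intros [A B]; split.
    + rewrite Rmult_1_l in A. rewrite A. ring.
    + rewrite Rmult_1_l in B. rewrite B. ring.
    + apply Rmult_integral in A. destruct A as [A|A]; [easy|rewrite A; ring].
    + apply Rmult_integral in B. destruct B as [B|B]; [easy|rewrite B; ring].
Qed.
End Exact.

(** * Dirichlet conditions and the leading-order form *)

Lemma cos_neq0_off_nodes (x : R) :
  (forall n : Z, x <> PI * (IZR n - 1 / 2)) -> cos x <> 0.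
Proof.
  intros H Hc. destruct (cos_eq_0_0 x Hc) as [j Hj].
  (* The library writes the zeros as j PI + PI/2, which is PI (n - 1/2) for n = j + 1. *)
  apply (H (j + 1)%Z). rewrite plus_IZR, Hj. field.
Qed.

Theorem theorem6 (k m q0 mu : R)
  (hk : 0 < k) (hm : 0 < m) (hq0 : 1 + 4 * k < 4 * q0)
  (hmu : mu = 1 / 2 * sqrt (4 * (q0 - k) - 1))
  (hm_node : forall n : Z, mu * ln m <> PI * (IZR n - 1 / 2))
  (hpim_node : forall n : Z, mu * ln (PI + m) <> PI * (IZR n - 1 / 2))
  (x0 : R) :
  let P :=
    {| sl_p := fun x => cos (mu * ln (1 + x + x0)) ^ 4;
       sl_q := fun _ => q0;
       sl_r := fun x => (1 + x + x0) ^ 2;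
       sl_a := - x0 + m - 1;
       sl_b := - x0 + PI + m - 1;
       sl_delta0 := m * cos (mu * ln m) ^ 2;
       sl_gamma0 := (PI + m) * cos (mu * ln (PI + m)) ^ 2 |} in
  asymptotic_canonical_form 1 k m
    (fun _ => q0) (fun tau => tau ^ 2)
    (fun tau => sqrt tau * cos (mu * ln tau)) x0 P /\
  sl_delta0 P <> 0 /\ sl_gamma0 P <> 0 /\
  (forall u : R -> R,
     sl_boundary P u <-> u (- x0 + m - 1) = 0 /\ u (- x0 + PI + m - 1) = 0).
Proof.
  intros P.
  pose proof PI_RGT_0 as Hpi.
  assert (Hs : 0 < sqrt (4 * (q0 - k) - 1)) by (apply sqrt_lt_R0; lra).
  assert (Hmu : 0 < mu) by lra.
  assert (Hmu2 : mu ^ 2 = q0 - k - 1 / 4).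
  { rewrite hmu, Rpow_mult_distr, pow2_sqrt by lra. field. }
  assert (Hcm := cos_neq0_off_nodes _ hm_node).
  assert (Hcp := cos_neq0_off_nodes _ hpim_node).
  assert (Hd : sl_delta0 P <> 0).
  { apply Rmult_integral_contrapositive. split; [lra|now apply pow_nonzero]. }
  assert (Hg : sl_gamma0 P <> 0).
  { apply Rmult_integral_contrapositive. split; [lra|now apply pow_nonzero]. }
  split; [|split; [exact Hd|split; [exact Hg|]]].
  - split; [now apply omega_liouville_solution|].
    destruct (phase_surjective mu Hmu) as [h Hh].
    exists (fun tau => phase mu (ln tau)), (fun tau => tau - 1), (exact_form m q0 mu x0 h).
    split; [now apply phase_ln_normalized|].
    split; [now apply exact_form_coefficients|].
    split; [now apply exact_form_transforms|].
    split; [now apply phase_ln_leading_term|].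
    change (fun tau : R => sqrt tau * cos (mu * ln tau)) with (omega mu).
    unfold coefficients_via, P; cbn [sl_p sl_q sl_r sl_a sl_b sl_delta0 sl_gamma0].
    rewrite !omega_sq by lra.
    split; [ring|]. split; [ring|]. split; [auto|]. split; [auto|]. split.
    (* The leading-order relation x + x0 = tau - 1 is solved for tau. *)
    + intros x Hx. exists (1 + x + x0). lra.
    + intros tau x Ht Hx. replace (1 + x + x0) with tau by lra.
      rewrite omega_pow4 by lra. repeat split; lra.
  - intros u. unfold sl_boundary. split; intros [A B]; split.
    + apply Rmult_integral in A. destruct A as [A|A]; [now elim Hd|exact A].
    + apply Rmult_integral in B. destruct B as [B|B]; [now elim Hg|exact B].
    + cbn [sl_a P]. rewrite A. ring.
    + cbn [sl_b P]. rewrite B. ring.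
Qed.
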